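(* Let $A$ be a finite-dimensional unital (not necessarily associative) algebra over a field $F$ (of any characteristic), and fix $\lambda\in F$. (a) For every Rota--Baxter operator $R$ of weight $\lambda$ on $A$ there exist integers $k,l\ge 0$ such that $R^k(R+\lambda\,\mathrm{id})^l=0$. In particular, $\mathrm{Spec}(R)\subset\{0,-\lambda\}$. (b) There exists a natural number $n$ such that for every Rota--Baxter operator $R$ of weight $\lambda$ on $A$ one can find $0\le k\le n$ with $R^k(R+\lambda\,\mathrm{id})^{n-k}(1)=0$. Moreover, $\mathrm{rb}_\lambda(A)\le 2n$.
   Context: An algebra over $F$ is an $F$-vector space $A$ with a bilinear product, not assumed associative or commutative; it is unital if it has a two-sided identity element $1$. For $\lambda\in F$, a linear operator $R\colon A\to A$ is a Rota--Baxter operator of weight $\lambda$ if $R(x)R(y)=R(R(x)y+xR(y)+\lambda xy)$ for all $x,y\in A$. $\mathrm{Spec}(R)$ is the spectrum (set of eigenvalues) of $R$. Natural numbers include $0$. The Rota--Baxter $\lambda$-index of $A$ is $$\mathrm{rb}_\lambda(A)=\min\{n\in\mathbb N\mid \text{for every Rota--Baxter operator } R \text{ of weight }\lambda\text{ on }A\text{ there exists } 0\le k\le n \text{ with } R^k(R+\lambda\,\mathrm{id})^{n-k}=0\},$$ and $\mathrm{rb}_\lambda(A)=\infty$ if no such $n$ exists. *)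

(* Defs.v *)
From HB Require Import structures.
From mathcomp Require Import all_boot all_order all_algebra.
From mathcomp Require Import boolp.
Set Implicit Arguments.
Unset Strict Implicit.
Unset Printing Implicit Defensive.
Import GRing.Theory.
Local Open Scope ring_scope.

Section RotaBaxter.
Variables (F : fieldType) (A : vectType F).

(* 'End(A) is not canonically a ring, since A may be the zero space. *)
Definition lfun_pow (f : 'End(A)) (k : nat) : 'End(A) :=
  iter k (comp_lfun f) \1%VF.

Definition rb_prod (lam : F) (R : 'End(A)) (k l : nat) : 'End(A) :=
  (lfun_pow R k \o lfun_pow (R + lam *: \1) l)%VF.

(* A need not be associative, so its product is a bare bilinear map. *)
Variable mul : {bilinear A -> A -> A}.

Definition rota_baxter (lam : F) (R : 'End(A)) : Prop :=
  forall x y : A,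
    mul (R x) (R y) = R (mul (R x) y + mul x (R y) + lam *: mul x y).

Definition rb_bound (lam : F) (n : nat) : Prop :=
  forall R : 'End(A), rota_baxter lam R ->
    exists2 k : nat, (k <= n)%N & rb_prod lam R k (n - k) = 0.

Lemma rb_bound_ex (lam : F) :
  (exists n, rb_bound lam n) -> exists n, `[< rb_bound lam n >].
Proof. by move=> [n hn]; exists n; apply/asboolP. Qed.

(* [None] stands for infinity. *)
Definition rb_index (lam : F) : option nat :=
  match pselect (exists n, rb_bound lam n) with
  | left h => Some (ex_minn (rb_bound_ex h))
  | right _ => None
  end.

End RotaBaxter.

(* The order of the naturals extended by infinity, against a finite bound. *)
Definition rb_index_le (r : option nat) (m : nat) : bool :=
  if r is Some n then (n <= m)%N else false.

(* Main.v *)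
From HB Require Import structures.
Require Import Defs.
From mathcomp Require Import all_boot all_order all_algebra.
From mathcomp Require Import boolp.
Set Implicit Arguments.
Unset Strict Implicit.
Unset Printing Implicit Defensive.
Import GRing.Theory.
Local Open Scope ring_scope.

(** Let [S = R + lam] and let [rho y] be right multiplication by [y].  Set
    [delta Z = Z R - R Z].  The Rota-Baxter identity says that
    [delta (rho (R y)) = R (rho y) S] and [delta (rho (S y)) = S (rho y) R].
    As [delta] commutes with [Z |-> R Z S] and [Z |-> S Z R], iterating from
    [rho 1 = id] yields [delta^(k+l) (rho (R^k S^l 1)) = R^(k+l) S^(k+l)].
    So [R^k S^l 1 = 0] forces [R^n S^n = 0] for [n = k + l].  Without this
    hypothesis, [R^n S^n = delta^n (rho (R^n 1))] is still killed by [delta],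
    hence vanishes once the kernels of the powers of [delta] are stationary. *)

Lemma iter_comm (T : Type) (f g : T -> T) (n : nat) :
  (forall x, f (g x) = g (f x)) ->
  forall x, iter n f (g x) = g (iter n f x).
Proof. by move=> fg x; elim: n => //= n ->. Qed.

Lemma iter_comm2 (T : Type) (f g : T -> T) (m n : nat) :
  (forall x, f (g x) = g (f x)) ->
  forall x, iter m f (iter n g x) = iter n g (iter m f x).
Proof. by move=> fg x; elim: n => //= n <-; apply: iter_comm. Qed.

Section Powers.
Variables (F : fieldType) (V : vectType F).
Implicit Types f : 'End(V).

Lemma lfun_powE f n v : lfun_pow f n v = iter n f v.
Proof. by elim: n => [|n IHn] /=; rewrite ?id_lfunE // comp_lfunE IHn. Qed.

Lemma iter_eigen f a v n : f v = a *: v -> iter n f v = a ^+ n *: v.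
Proof.
move=> fv; elim: n => [|n IHn] /=; first by rewrite scale1r.
by rewrite IHn linearZ /= fv scalerA -exprSr.
Qed.

(** The kernels of the powers of [g] form an increasing chain; were the first [\dim {:V} + 1]
    inclusions all strict, one of these kernels would have dimension larger than [V]. *)
Lemma ker_pow_stationary (g : {linear V -> V}) :
  exists2 n, (n <= \dim {:V})%N &
    forall v, iter n.+1 g v = 0 -> iter n g v = 0.
Proof.
pose K n := lker (lfun_pow (linfun g) n).
have memK n v : (v \in K n) = (iter n g v == 0).
  by rewrite memv_ker lfun_powE (eq_iter (lfunE g)).
have KS n : (K n <= K n.+1)%VS.
  by apply/subvP => v; rewrite !memK iterS => /eqP->; rewrite linear0.
have [[n len dimK]|growK] :
    (exists2 n, (n <= \dim {:V})%N & (\dim (K n.+1) <= \dim (K n))%N) \/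
    (forall n, (n <= \dim {:V})%N -> (\dim (K n) < \dim (K n.+1))%N).
- case: (boolP [exists n : 'I_(\dim {:V}).+1, (\dim (K n.+1) <= \dim (K n))%N]).
    by case/existsP => n dimK; left; exists n; rewrite // -ltnS.
  move/existsPn => growK; right=> n len.
  by have := growK (Ordinal (len : (n < (\dim {:V}).+1)%N)); rewrite -ltnNge.
- exists n => // v fv.
  have /eqP eqK : K n == K n.+1 by rewrite eqEdim KS.
  by apply/eqP; rewrite -memK eqK memK fv.
have dim_ge n : (n <= (\dim {:V}).+1)%N -> (n <= \dim (K n))%N.
  elim: n => // n IHn len.
  by apply: leq_ltn_trans (growK n len); apply: IHn; apply: ltnW.
have := leq_trans (dim_ge _ (leqnn _)) (dimvS (subvf _)).
by rewrite ltnn.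
Qed.

End Powers.

Section Commutator.
Variables (F : fieldType) (A : vectType F).
Implicit Types R S T Z : 'End(A).

Definition commr R Z : 'End(A) := ((Z \o R) - (R \o Z))%VF.

Lemma commrE R Z x : commr R Z x = Z (R x) - R (Z x).
Proof. by rewrite add_lfunE opp_lfunE !comp_lfunE. Qed.

(** Linearity makes [commr R] an endomorphism of the finite-dimensional space ['End(A)], to which
    [ker_pow_stationary] applies. *)
Lemma commr_is_linear R : linear (commr R).
Proof.
move=> a Z1 Z2; apply/lfunP => x.
rewrite !(commrE, add_lfunE, scale_lfunE).
by rewrite linearD linearZ /= scalerBr opprD addrACA.
Qed.

HB.instance Definition _ R :=
  GRing.isLinear.Build F 'End(A) 'End(A) _ (commr R) (commr_is_linear R).

Definition sandwich S T Z : 'End(A) := (S \o Z \o T)%VF.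

Lemma sandwichE S T Z x : sandwich S T Z x = S (Z (T x)).
Proof. by rewrite !comp_lfunE. Qed.

(** Both outer factors commute with [R], so the commutator only reaches the middle one. *)
Lemma commr_sandwich R S T Z :
  (R \o S = S \o R)%VF -> (R \o T = T \o R)%VF ->
  commr R (sandwich S T Z) = sandwich S T (commr R Z).
Proof.
move=> RS RT; rewrite /commr /sandwich comp_lfunDr comp_lfunDl.
by rewrite comp_lfunNr comp_lfunNl !comp_lfunA RS -!comp_lfunA RT.
Qed.

Lemma iter_sandwich S T n Z x :
  iter n (sandwich S T) Z x = iter n S (Z (iter n T x)).
Proof.
elim: n x => //= n IHn x.
by rewrite sandwichE IHn -iterSr.
Qed.

End Commutator.

Section RotaBaxterUnital.
Variables (F : fieldType) (A : vectType F) (mul : {bilinear A -> A -> A}).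
Variables (lam : F) (R : 'End(A)).
Hypothesis rbR : rota_baxter mul lam R.

Let S : 'End(A) := R + lam *: \1%VF.

Lemma addscaleE x : S x = R x + lam *: x.
Proof. by rewrite add_lfunE scale_lfunE id_lfunE. Qed.

Lemma addscale_comm : (R \o S = S \o R)%VF.
Proof.
by apply/lfunP => x; rewrite !comp_lfunE !addscaleE linearD linearZ.
Qed.

Lemma rb_prodE k l x : rb_prod lam R k l x = iter k R (iter l S x).
Proof. by rewrite comp_lfunE !lfun_powE. Qed.

Definition rmul y : 'End(A) := linfun (mul^~ y).

Lemma rmulE y x : rmul y x = mul x y.
Proof. exact: (lfunE (applyr mul y)). Qed.

Lemma rmul0 : rmul 0 = 0.
Proof. by apply/lfunP => x; rewrite rmulE linear0r zero_lfunE. Qed.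

(** Moving R(x R(y)) to the left of the Rota-Baxter identity leaves R(R(x) y + lam x y) = R(S(x)
    y). *)
Lemma commr_rmulR y : commr R (rmul (R y)) = sandwich R S (rmul y).
Proof.
apply/lfunP => x; rewrite commrE sandwichE !rmulE rbR addscaleE.
rewrite linearDl linearZl_LR /= -linearB /=; congr (R _).
by rewrite addrAC addrK.
Qed.

(** Expanding S(y) = R(y) + lam y, the terms R(x R(y)) and lam R(x y) cancel, and R(R(x) y) + lam
    R(x) y = S(R(x) y) remains. *)
Lemma commr_rmulS y : commr R (rmul (S y)) = sandwich S R (rmul y).
Proof.
apply/lfunP => x; rewrite commrE sandwichE !rmulE.
rewrite !addscaleE !linearDr !linearZr_LR /= rbR !linearD !linearZ /=.
by rewrite -(addrA (R (mul (R x) y))) addrAC scalerN -opprD addrK.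
Qed.

Lemma iter_commr_rmulR n y :
  iter n (commr R) (rmul (iter n R y)) = iter n (sandwich R S) (rmul y).
Proof.
elim: n => // n IHn; rewrite iterSr /= commr_rmulR.
rewrite iter_comm ?IHn // => Z.
exact: commr_sandwich addscale_comm.
Qed.

Lemma iter_commr_rmulS n y :
  iter n (commr R) (rmul (iter n S y)) = iter n (sandwich S R) (rmul y).
Proof.
elim: n => // n IHn; rewrite iterSr /= commr_rmulS.
rewrite iter_comm ?IHn // => Z.
exact: commr_sandwich addscale_comm _.
Qed.

(** The first [k] commutators absorb the powers of [R]; the other [l] pass through the resulting
    sandwich and absorb those of [S]. *)
Lemma rb_prod_iter_commr k l x y :
  iter (l + k) (commr R) (rmul (iter k R (iter l S y))) x =
  iter k R (iter l S (mul (iter l R (iter k S x)) y)).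
Proof.
rewrite iterD iter_commr_rmulR iter_comm2; last first.
  by move=> Z; apply: commr_sandwich addscale_comm.
by rewrite iter_commr_rmulS !iter_sandwich rmulE.
Qed.

Lemma RS_comm x : R (S x) = S (R x).
Proof. by rewrite -!comp_lfunE addscale_comm. Qed.

Lemma rb_prod_mono m n : (m <= n)%N ->
  rb_prod lam R m m = 0 -> rb_prod lam R n n = 0.
Proof.
move=> le_mn RS0; apply/lfunP => x; rewrite rb_prodE zero_lfunE.
rewrite -(subnK le_mn) iterD addnC iterD -rb_prodE RS0 zero_lfunE.
by rewrite -lfun_powE linear0.
Qed.

(** On an eigenvector for [a], the product R^k S^l acts as the scalar a^k (a + lam)^l, which must
    then vanish. *)
Lemma rb_prod_eigen k l a : rb_prod lam R k l = 0 ->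
  passmx.leigenvalue R a -> a = 0 \/ a = - lam.
Proof.
(* The eigenvalue condition says that the eigenspace is nonzero, so [vpick] supplies a nonzero
   eigenvector. *)
move=> RS0; rewrite /passmx.leigenvalue /passmx.leigenspace -vpick0.
set v := vpick _ => v0.
have Rv : R v = a *: v.
  have := memv_pick (lker (R - a *: \1%VF)); rewrite -/v memv_ker.
  by rewrite add_lfunE opp_lfunE scale_lfunE id_lfunE subr_eq0 => /eqP.
have Sv : S v = (a + lam) *: v by rewrite addscaleE Rv scalerDl.
have := rb_prodE k l v; rewrite RS0 zero_lfunE (iter_eigen l Sv).
rewrite -lfun_powE linearZ /= lfun_powE (iter_eigen k Rv) scalerA.
move/esym/eqP; rewrite scaler_eq0 (negPf v0) orbF mulf_eq0 !expf_eq0.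
case/orP=> /andP[_ /eqP]; first by right; apply/eqP; rewrite -addr_eq0; apply/eqP.
by left.
Qed.

Variable one : A.
Hypothesis mulx1 : right_id one mul.

Lemma rb_prod_of_one k l :
  rb_prod lam R k l one = 0 -> rb_prod lam R (k + l) (k + l) = 0.
Proof.
rewrite rb_prodE => RS1; apply/lfunP => x.
have := rb_prod_iter_commr k l x one.
rewrite RS1 rmul0 iter_fix ?linear0 // mulx1 => ->.
(* What vanishes is R^k S^l R^l S^k x; exchanging the two inner powers collects the exponents. *)
by rewrite rb_prodE -(iter_comm2 l l RS_comm) iterD (addnC k) iterD.
Qed.

(** The exponent depends on [A] alone, so it serves all Rota-Baxter operators at once, as the
    uniform bound of part (b) requires. *)
Lemma rb_prod_dim :
  rb_prod lam R (\dim {:'End(A)}) (\dim {:'End(A)}) = 0.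
Proof.
have [n len stat] := ker_pow_stationary (commr R).
have rb_commr : iter n (commr R) (rmul (iter n R one)) = rb_prod lam R n n.
  apply/lfunP => x.
  by rewrite (rb_prod_iter_commr n 0) mulx1 rb_prodE.
apply: rb_prod_mono len _; rewrite -rb_commr; apply: stat.
(* One more commutator kills R^n S^n, because [R] commutes with itself and with [S]. *)
rewrite iterS rb_commr; apply/lfunP => x; rewrite commrE zero_lfunE.
have SR y : S (R y) = R (S y) by rewrite RS_comm.
by rewrite !rb_prodE (iter_comm n SR) (@iter_comm _ R R) ?subrr.
Qed.

End RotaBaxterUnital.

Theorem mainTheorem1 (F : fieldType) (A : vectType F)
    (mul : {bilinear A -> A -> A}) (one : A)
    (mul1x : left_id one mul) (mulx1 : right_id one mul) (lam : F) :
  (forall R : 'End(A), rota_baxter mul lam R ->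
     (exists k l : nat, rb_prod lam R k l = 0) /\
     (forall a : F, passmx.leigenvalue R a -> a = 0 \/ a = - lam)) /\
  ((exists n : nat, forall R : 'End(A), rota_baxter mul lam R ->
      exists2 k : nat, (k <= n)%N & rb_prod lam R k (n - k) one = 0) /\
   (forall n : nat,
      (forall R : 'End(A), rota_baxter mul lam R ->
         exists2 k : nat, (k <= n)%N & rb_prod lam R k (n - k) one = 0) ->
      rb_index_le (rb_index mul lam) (2 * n))).
Proof.
split=> [R rbR|].
  have RS0 := rb_prod_dim rbR mulx1.
  by split=> [|a]; [do 2!eexists; exact: RS0 | exact: rb_prod_eigen RS0].
split.
  pose d := \dim {:'End(A)}; exists (d + d)%N => R rbR.
  exists d; first exact: leq_addr.
  by rewrite addnK (rb_prod_dim rbR mulx1) zero_lfunE.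
move=> n bound1.
have bound : rb_bound mul lam (2 * n).
  move=> R rbR; have [k lekn RS1] := bound1 R rbR.
  (* The split of 2n into equal halves works whatever [k] is, since [rb_prod_of_one] sees only the
     sum k + (n - k) = n. *)
  exists n; first by rewrite leq_pmull.
  rewrite mul2n -addnn addnK -(subnKC lekn).
  exact: (rb_prod_of_one rbR mulx1 RS1).
(* The bound just found rules out the infinite value, and minimality of the index gives the
   inequality. *)
rewrite /rb_index; case: pselect => [ex|]; last by case; exists (2 * n)%N.
by rewrite /rb_index_le; case: ex_minnP => m _; apply; apply/asboolP.
Qed.
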